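(* Let $(P,\pi)$ be a complex Poisson manifold, let $p_0\in P$ be such that $\pi(p_0)=0$, and let $\pi_0$ be the linearization of $\pi$ at $p_0$. Let $\varphi,\psi$ be non-zero local holomorphic functions on $P$ defined near $p_0$. If $\{\varphi,\psi\}_\pi=\lambda\varphi\psi$ for some $\lambda\in\mathbb C$, then the lowest degree terms at $p_0$ satisfy $\{\varphi^{\rm low},\psi^{\rm low}\}_{\pi_0}=0$.
   Context: The linearization $\pi_0$ of $\pi$ at $p_0$ is the linear Poisson structure on $T_{p_0}P$ determined by $\{d_{p_0}f,d_{p_0}g\}_{\pi_0}=d_{p_0}(\{f,g\}_\pi)$ for local holomorphic functions $f,g$ near $p_0$ (covectors are viewed as linear functions on $T_{p_0}P$). Lowest degree term: in local holomorphic coordinates $z=(z_1,\dots,z_n)$ near $p_0$ with $z(p_0)=0$, also viewed as linear coordinates $d_{p_0}z_j$ on $T_{p_0}P$, write a non-zero $\varphi=\sum_\epsilon c_\epsilon z^\epsilon$ and let $e$ be the smallest $\epsilon_1+\cdots+\epsilon_n$ with $c_\epsilon\ne0$; then $\varphi^{\rm low}=\sum_{\epsilon_1+\cdots+\epsilon_n=e}c_\epsilon z^\epsilon$, a homogeneous polynomial function on $T_{p_0}P$ which is independent of the choice of coordinates. *)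

(* Defs.v *)
From HB Require Import structures.
From mathcomp Require Import all_boot all_order all_algebra.
From mathcomp Require Import all_classical all_reals all_analysis.
From mathcomp Require Import complex.
(* The notations of mpoly.v clash with those of MathComp-Analysis. *)
From mathcomp Require Import -(notations) mpoly.

Set Implicit Arguments.
Unset Strict Implicit.
Unset Printing Implicit Defensive.
Import Order.TTheory GRing.Theory Num.Theory.
Import numFieldNormedType.Exports.

Local Open Scope classical_set_scope.
Local Open Scope ring_scope.

Definition Cplx (R : realType) : numClosedFieldType := complex R.

Section Analytic.
Context {R : realType} {n : nat}.
Local Notation C := (Cplx R).

Definition monom_at (h : 'rV[C]_n) (m : multinom n) : C :=
  \prod_(i < n) h 0 i ^+ m i.

(* f (a + h) = \sum_m c m * h ^ m for all h in a neighbourhood of 0, the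
   multiple series being absolutely convergent there.  The partial sums are
   over the multi-indices of total degree < N, which is harmless thanks to
   absolute convergence. *)
Definition power_series_at (f : 'rV[C]_n -> C) (a : 'rV[C]_n)
    (c : multinom n -> C) : Prop :=
  \forall h \near (0 : 'rV[C]_n),
    (exists B : C, forall N : nat,
      \sum_(m : bmultinom n N) `|c m * monom_at h m| <= B) /\
    (fun N : nat => \sum_(m : bmultinom n N) c m * monom_at h m)
      @ \oo --> f (a + h).

(* Holomorphy in several variables is taken in the power series sense. *)
Definition analytic_at (f : 'rV[C]_n -> C) (a : 'rV[C]_n) : Prop :=
  exists c, power_series_at f a c.

End Analytic.

(* Homeomorphism from an open subset of P onto an open subset of C^n; cmap and
   cinv are meaningful only on cdom and its image. *)
Record chart (R : realType) (P : topologicalType) (n : nat) := Chart {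
  cdom : set P ;
  cmap : P -> 'rV[Cplx R]_n ;
  cinv : 'rV[Cplx R]_n -> P ;
  cdom_open : open cdom ;
  cimg_open : open (cmap @` cdom) ;
  cmapK : forall p, cdom p -> cinv (cmap p) = p ;
  cmap_cont : forall p, cdom p -> {for p, continuous cmap} ;
  cinv_cont : forall p, cdom p -> {for cmap p, continuous cinv}
}.

Section Manifold.
Context {R : realType} {P : topologicalType} {n : nat}.
Local Notation C := (Cplx R).
Local Notation chart := (chart R P n).

Definition holo_transition (z w : chart) : Prop :=
  forall p, cdom z p -> cdom w p -> forall i : 'I_n,
    analytic_at (fun x => cmap w (cinv z x) 0 i) (cmap z p).

Definition compatible (z w : chart) : Prop :=
  holo_transition z w /\ holo_transition w z.

(* A is the maximal atlas of an n-dimensional complex manifold: its elements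
   are all the local holomorphic coordinate systems. *)
Record complex_manifold (A : set chart) : Prop := ComplexManifold {
  mfd_hausdorff : hausdorff_space P ;
  mfd_countable : @second_countable P ;
  mfd_cover : forall p, exists2 z, A z & cdom z p ;
  mfd_compat : forall z w, A z -> A w -> compatible z w ;
  mfd_max : forall z, (forall w, A w -> compatible z w) -> A z
}.

Definition holo_at (A : set chart) (f : P -> C) (p : P) : Prop :=
  forall z, A z -> cdom z p -> analytic_at (f \o cinv z) (cmap z p).

Definition local_holo (A : set chart) (f : P -> C) (p : P) : Prop :=
  \forall q \near p, holo_at A f q.

Definition partial_d (z : chart) (j : 'I_n) (f : P -> C) (p : P) : C :=
  'D_(delta_mx 0 j) (f \o cinv z) (cmap z p).

Definition jacobian (z w : chart) (p : P) : 'M[C]_n :=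
  \matrix_(i, j) partial_d z j (fun q => cmap w q 0 i) p.

(* A field of bivectors is given by its components in all charts: Pi z p is the
   matrix of the skew form (z_i, z_j) |-> Pi(p)(d_p z_i, d_p z_j) on the
   cotangent space, so that Pi = 1/2 \sum_(i, j) Pi z i j d/dz_i /\ d/dz_j. *)
Record holo_bivector (A : set chart) (Pi : chart -> P -> 'M[C]_n) : Prop :=
  HoloBivector {
  biv_skew : forall z p, A z -> cdom z p -> (Pi z p)^T = - Pi z p ;
  biv_holo : forall z p i j, A z -> cdom z p ->
    holo_at A (fun q => Pi z q i j) p ;
  biv_transition : forall z w p, A z -> A w -> cdom z p -> cdom w p ->
    Pi w p = jacobian z w p *m Pi z p *m (jacobian z w p)^T
}.

(* {f, g}_Pi = Pi(df, dg) on the domain of z; by biv_transition its value at p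
   is the same for all charts z at p. *)
Definition pbracket (Pi : chart -> P -> 'M[C]_n) (z : chart)
    (f g : P -> C) (p : P) : C :=
  \sum_(i < n) \sum_(j < n) Pi z p i j * partial_d z i f p * partial_d z j g p.

Record poisson_manifold (A : set chart) (Pi : chart -> P -> 'M[C]_n) : Prop :=
  PoissonManifold {
  pm_manifold : complex_manifold A ;
  pm_bivector : holo_bivector A Pi ;
  pm_jacobi : forall z p f g h, A z -> cdom z p ->
    local_holo A f p -> local_holo A g p -> local_holo A h p ->
    pbracket Pi z f (pbracket Pi z g h) p
    + pbracket Pi z g (pbracket Pi z h f) p
    + pbracket Pi z h (pbracket Pi z f g) p = 0
}.

(* Polynomial functions on the tangent space at p are written in the linear
   coordinates d_p z_1, ..., d_p z_n, i.e. 'X_j stands for d_p z_j. *)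
Definition lin_var (j : 'I_n) : mpoly n C :=
  mpolyX C (mnm1 j).

(* d_p f as a linear function on the tangent space *)
Definition differential_at (z : chart) (f : P -> C) (p : P) :
    mpoly n C :=
  \sum_(j < n) partial_d z j f p *: lin_var j.

Definition poly_bracket (Q : 'M[mpoly n C]_n) (F G : mpoly n C) :
    mpoly n C :=
  \sum_(i < n) \sum_(j < n) Q i j * mderiv i F * mderiv j G.

Record linear_poisson (Q : 'M[mpoly n C]_n) : Prop := LinearPoisson {
  lp_skew : Q^T = - Q ;
  lp_linear : forall i j,
    exists a : 'I_n -> C, Q i j = \sum_(k < n) a k *: lin_var k ;
  lp_jacobi : forall F G H,
    poly_bracket Q F (poly_bracket Q G H)
    + poly_bracket Q G (poly_bracket Q H F)
    + poly_bracket Q H (poly_bracket Q F G) = 0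
}.

(* The differentials of local holomorphic functions exhaust the linear
   functions on the tangent space, so the second clause determines Q. *)
Definition is_linearization (A : set chart) (Pi : chart -> P -> 'M[C]_n)
    (z : chart) (p : P) (Q : 'M[mpoly n C]_n) : Prop :=
  linear_poisson Q /\
  forall f g, local_holo A f p -> local_holo A g p ->
    poly_bracket Q (differential_at z f p) (differential_at z g p)
    = differential_at z (pbracket Pi z f g) p.

Definition is_lowest_term (z : chart) (f : P -> C) (p : P)
    (L : mpoly n C) : Prop :=
  exists (c : multinom n -> C) (e : nat),
    [/\ power_series_at (f \o cinv z) (cmap z p) c,
        exists2 m, mdeg m = e & c m != 0,
        forall m, (mdeg m < e)%N -> c m = 0
      & L = \sum_(m : bmultinom n e.+1 | mdeg m == e)
              c m *: mpolyX C m].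

End Manifold.

(* Main.v *)
Require Import Defs.
From mathcomp Require Import all_boot all_order all_algebra.
From mathcomp Require Import all_classical all_reals all_analysis.
From mathcomp Require Import ring.
From mathcomp Require Import -(notations) mpoly.
Import Order.TTheory GRing.Theory Num.Theory numFieldNormedType.Exports.
Local Open Scope classical_set_scope.
Local Open Scope ring_scope.

(** The proof compares orders of vanishing at the centre of the chart. Let phi
and psi have lowest terms of degrees e + 1 and d + 1 (if one of these degrees is
0, that lowest term is constant and the bracket is trivially 0). Since the
bivector vanishes at p0, its entries have order at least 1, with linear parts the
entries Q i j of the linearization. In

    {phi, psi} = sum over i, j of Pi i j * d_i phi * d_j psi

the part of degree 1 + e + d is therefore the bracket of the two lowest terms
for the linearization, whereas lambda phi psi has order at least e + d + 2. So
this part is 0.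

The comparison is made on each complex line through 0: with x = t v, divide the
identity by t ^ (1 + e + d) and let t tend to 0. The left-hand side tends to the
value at v of the polynomial bracket (power_series_leading for the entries of
the bivector, identified by linearization_entry; power_series_derive_leading for
the partial derivatives), the right-hand side tends to 0, and a polynomial
function which is 0 at every v is the zero polynomial (mpoly_eq0_meval).

What is needed about power series is contained in power_series_taylor: the
Taylor remainder of order E has a Lipschitz constant O(s ^ E) on the ball of
radius s. A bound on difference quotients is a bound on the derivative, so this
controls the remainder and its first partial derivatives at once. *)

(* Without this, simplification replaces Cplx R by its representation, on which the
   canonical structures of the complex numbers are not found. *)
Local Opaque Cplx.

(** * Polynomial functions *)

Section Polynomials.
Context {C : numFieldType} {n : nat}.
Implicit Types (p q : mpoly n C) (x y v : 'rV[C]_n) (m : multinom n).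

Lemma normr_coord_le x i : `|x 0 i| <= `|x|.
Proof.
rewrite {2}/Num.norm /= mx_normE -[leLHS]nngE num_le.
exact: (le_bigmax _ (fun ij : 'I_1 * 'I_n => `|x ij.1 ij.2|%:nng) (0, i)).
Qed.

Lemma is_derive_coord x v i : is_derive x v (fun y : 'rV[C]_n => y 0 i) (v 0 i).
Proof.
have H : (fun h : C => h^-1 *: (((fun y : 'rV[C]_n => y 0 i) \o shift x) (h *: v)
    - x 0 i)) @ 0^' --> v 0 i.
  apply: cvg_near_cst; near=> h; rewrite /= !mxE addrK.
  have hN0 : h != 0 by near: h; exact: nbhs_dnbhs_neq.
  by rewrite /GRing.scale /= mulKf.
apply: DeriveDef; first by apply/cvg_ex; exists (v 0 i).
exact: cvg_lim H.
Unshelve. all: by end_near. Qed.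

Lemma mderiv_var i j : mderiv i (mpolyX C (mnm1 j)) = (i == j)%:R :> mpoly n C.
Proof.
rewrite mderivX mnm1E eq_sym; case: eqVneq => [->|]; last by rewrite scale0r.
suff -> : mnm_sub (mnm1 j) (mnm1 j) = mnm0 by rewrite scale1r mpolyX0.
by apply/mnmP => k; rewrite mnmBE mnm0E subnn.
Qed.

Lemma mnm_neq0 m : m != mnm0 -> exists i, m i != 0%N.
Proof.
move=> m0; apply/existsP; apply: contraNT m0 => /existsPn m0.
by apply/eqP/mnmP => i; rewrite mnm0E; apply/eqP/negPn.
Qed.

(** The formal and the analytic partial derivatives agree on variables and
constants and obey the same sum and product rules. *)
Lemma is_derive_meval p x i :
  is_derive x (delta_mx 0 i) (fun y : 'rV[C]_n => meval (y 0) p)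
    (meval (x 0) (mderiv i p)).
Proof.
pose D p := is_derive x (delta_mx 0 i) (fun y : 'rV[C]_n => meval (y 0) p)
  (meval (x 0) (mderiv i p)).
have DC c : D (mpolyC n c).
  rewrite /D mderivC meval0 (_ : (fun _ => _) = cst c); first exact: is_derive_cst.
  by apply/funext => y; rewrite mevalC.
have DD q r : D q -> D r -> D (q + r).
  move=> dq dr; rewrite /D mderivD mevalD.
  rewrite (_ : (fun _ => _) = (fun y : 'rV[C]_n => meval (y 0) q) + (fun y : 'rV[C]_n => meval (y 0) r)).
    exact: is_deriveD.
  by apply/funext => y; rewrite mevalD.
have DM q r : D q -> D r -> D (q * r).
  move=> dq dr; rewrite /D mderivM mevalD !mevalM addrC.
  rewrite (_ : (fun _ => _) = (fun y : 'rV[C]_n => meval (y 0) q) * (fun y : 'rV[C]_n => meval (y 0) r)).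
    by rewrite (mulrC (meval (x 0) (mderiv i q))); exact: is_deriveM.
  by apply/funext => y; rewrite mevalM.
have DX j : D (mpolyX C (mnm1 j)).
  rewrite /D (_ : (fun _ => _) = (fun y : 'rV[C]_n => y 0 j)); last first.
    by apply/funext => y; rewrite mevalXU.
  have -> : meval (x 0) (mderiv i (mpolyX C (mnm1 j))) =
      (delta_mx 0 i : 'rV[C]_n) 0 j.
    by rewrite mderiv_var -mpolyC_nat mevalC mxE eqxx eq_sym.
  exact: is_derive_coord.
elim/mpolyind: p => [|c m p _ _ Dp]; first by have := DC 0; rewrite mpolyC0.
apply: (DD) Dp; rewrite -mul_mpolyC; apply: (DM) => //.
rewrite mpolyXE_id; elim/big_ind: _ => // [|j _]; first by rewrite -mpolyC1.
elim: (m j) => [|k IHk]; first by rewrite expr0 -mpolyC1.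
by rewrite exprS; exact: (DM).
Qed.

Lemma meval_at0 p : meval (fun=> 0) p = mcoeff mnm0 p.
Proof.
elim/mpolyind: p => [|c m p _ _ IHp]; first by rewrite meval0 mcoeff0.
rewrite mevalD mevalZ mevalX mcoeffD mcoeffZ mcoeffX IHp; congr (_ * _ + _).
case: eqVneq => [->|m0]; first by rewrite big1// => i _; rewrite mnm0E expr0.
have [i mi] := mnm_neq0 _ m0.
by rewrite (bigD1 i)//= expr0n (negPf mi) mul0r.
Qed.

(** If p vanishes everywhere, so do the functions defined by all its iterated
partial derivatives; their values at 0 are factorial multiples of the
coefficients of p, which are thus 0 in characteristic 0. *)
Lemma mpoly_eq0_meval p : (forall x : 'rV[C]_n, meval (x 0) p = 0) -> p = 0.
Proof.
move=> p0; apply/mpolyP => m; rewrite mcoeff0.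
elim: {m}(mdeg m) {-2}m (erefl (mdeg m)) p p0 => [|d IHd] m md p p0.
  have /eqP -> : m == mnm0 by rewrite -mdeg_eq0 md.
  by rewrite -meval_at0 -(p0 0); apply: meval_eq => i; rewrite mxE.
have [i mi] : exists i, m i != 0%N by apply: mnm_neq0; rewrite -mdeg_eq0 md.
have mE : mnm_add (mnm_sub m (mnm1 i)) (mnm1 i) = m.
  apply/mnmP => j; rewrite mnmDE mnmBE mnm1E subnK//.
  by case: eqVneq => // <-; rewrite lt0n.
have /eqP : mcoeff (mnm_sub m (mnm1 i)) (mderiv i p) = 0.
  apply: IHd => [|x].
    by move: md; rewrite -{1}mE mdegD mdeg1 addn1 => -[].
  have /@derive_val <- := is_derive_meval p x i.
  rewrite (_ : (fun _ => _) = cst 0) ?derive_cst//.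
  by apply/funext => y; rewrite p0.
by rewrite mcoeff_deriv mE mulrn_eq0 => /eqP.
Qed.

Lemma meval_homog e p (t : C) x : (forall m, mcoeff m p != 0 -> mdeg m = e) ->
  meval ((t *: x) 0) p = t ^+ e * meval (x 0) p.
Proof.
move=> hp; rewrite !mevalE mulr_sumr; apply: eq_big_seq => m.
rewrite mcoeff_msupp => /hp <-; rewrite mulrCA; congr (_ * _).
rewrite mdegE -prodrXr -big_split /=; apply: eq_bigr => i _.
by rewrite mxE exprMn.
Qed.

(** The factor r on the left keeps the estimate free of the exponent |m| - 1,
so that it is stable under products of monomials. *)
Lemma monom_lipschitz (r : C) x y m : `|x| <= r -> `|y| <= r ->
  r * `|\prod_(i < n) x 0 i ^+ m i - \prod_(i < n) y 0 i ^+ m i|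
    <= (mdeg m)%:R * r ^+ mdeg m * `|x - y|.
Proof.
move=> xr yr; have r0 : 0 <= r := le_trans (normr_ge0 x) xr.
set d := `|x - y|.
(* The three bounds together pass from two factors of degrees k and l to their
   product of degree k + l. *)
pose L (k : nat) (a b : C) :=
  [/\ `|a| <= r ^+ k, `|b| <= r ^+ k & r * `|a - b| <= k%:R * r ^+ k * d].
have L1 : L 0%N 1 1 by split; rewrite ?normr1 ?expr0// subrr normr0 mulr0 !mul0r.
have LM k l a b a' b' : L k a b -> L l a' b' -> L (k + l)%N (a * a') (b * b').
  move=> [ak bk abk] [al bl abl]; split; try by rewrite normrM exprD ler_pM.
  have -> : a * a' - b * b' = a * (a' - b') + (a - b) * b'.
    by rewrite mulrBr mulrBl addrA subrK.
  apply: (@le_trans _ _ (r * (`|a| * `|a' - b'| + `|a - b| * `|b'|))).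
    by rewrite ler_wpM2l// -!normrM ler_normD.
  rewrite mulrDr exprD natrD !mulrDl addrC lerD//.
    rewrite [leRHS](_ : _ = (k%:R * r ^+ k * d) * r ^+ l); last by ring.
    by rewrite mulrA ler_pM ?mulr_ge0.
  rewrite [leRHS](_ : _ = r ^+ k * (l%:R * r ^+ l * d)); last by ring.
  by rewrite mulrCA ler_pM ?mulr_ge0.
have LX i : L (m i) (x 0 i ^+ m i) (y 0 i ^+ m i).
  elim: (m i) => [|k IHk]; rewrite ?expr0// !exprS -add1n; apply: LM => //.
  split; rewrite ?expr1 ?mul1r ?(le_trans (normr_coord_le _ _))//.
  by rewrite ler_wpM2l//; have := normr_coord_le (x - y) i; rewrite !mxE.
suff [] : L (mdeg m) (\prod_(i < n) x 0 i ^+ m i) (\prod_(i < n) y 0 i ^+ m i) by [].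
by rewrite mdegE; elim/big_rec3: _ => // i k a b _; exact: LM.
Qed.

End Polynomials.

(** * Limits along lines *)

Lemma norm_cvg_le {C : numFieldType} {T : Type} (F : set_system T)
    {FF : ProperFilter F} (f : T -> C) (l b : C) :
  f @ F --> l -> (\forall t \near F, `|f t| <= b) -> `|l| <= b.
Proof.
move=> fl fb; apply/ler_addgt0Pr => e e0.
have [t [ft lt]] := filter_ex (filterI fb ((cvgrPdist_le _ _).1 fl e e0)).
rewrite -[l](subrK (f t)) addrC (le_trans (ler_normD _ _))// lerD//.
Qed.

Section Limits.
Context {C : numFieldType}.

Lemma cvg_dnbhs0_linear (u : C -> C) (l M : C) :
  (\forall t \near 0^', `|u t - l| <= M * `|t|) -> u @ 0^' --> l.
Proof.
move=> ub; apply/cvgrPdistC_le => e e0.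
have M0 : 0 < 1 + `|M| by rewrite ltr_pwDl.
near=> t.
apply: (@le_trans _ _ (M * `|t|)); first by near: t.
(* The order on C is partial: M has to be shown to be real. *)
have MR : M \is Num.real.
  have /le_trans : 0 <= `|u t - l| by [].
  move=> /(_ (M * `|t|)) H.
  have t0 : 0 < `|t| by rewrite normr_gt0; near: t; exact: nbhs_dnbhs_neq.
  rewrite ger0_real// -(pmulr_lge0 _ t0); apply: H; near: t; exact: ub.
apply: (@le_trans _ _ ((1 + `|M|) * `|t|)).
  by rewrite ler_wpM2r// (le_trans (real_ler_norm _))// lerDr.
rewrite mulrC -ler_pdivlMr//; near: t; apply: dnbhs0_le; exact: divr_gt0.
Unshelve. all: by end_near. Qed.

Lemma near_line {V : normedModType C} (v : V) (A : set V) :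
  (\forall x \near 0, A x) -> \forall t \near (0 : C), A (t *: v).
Proof.
have : (fun t : C => t *: v) @ 0 --> (0 : V).
  rewrite -[X in _ --> X](scale0r v); exact: (@scalel_continuous C V v 0).
exact.
Qed.

Context {V : normedModType C}.
Implicit Types (f : V -> C) (x v : V).

Lemma derive_norm_le f x v (b : C) : derivable f x v ->
  (\forall h \near 0^', `|f (h *: v + x) - f x| <= b * `|h *: v|) ->
  `|'D_v f x| <= b * `|v|.
Proof.
move=> df fb; apply: (norm_cvg_le _ _ _ _ df).
near=> h; have h0 : 0 < `|h| by rewrite normr_gt0; near: h; exact: nbhs_dnbhs_neq.
rewrite normrZ normfV mulrC ler_pdivrMr// -mulrA -[`|v| * _]mulrC -normrZ.
near: h; exact: fb.
Unshelve. all: by end_near. Qed.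

Lemma is_derive0_quadratic f v (K : C) :
  (\forall x \near 0, `|f x - f 0| <= K * `|x| ^+ 2) -> is_derive 0 v f 0.
Proof.
move=> fK.
suff H : (fun h : C => h^-1 *: ((f \o shift 0) (h *: v) - f 0)) @ 0^' --> (0 : C).
  by apply: DeriveDef; [apply/cvg_ex; exists 0|exact: cvg_lim H].
apply: (@cvg_dnbhs0_linear _ _ (K * `|v| ^+ 2)).
have := nbhs_dnbhs (near_line v _ fK); apply: filterS2 (nbhs_dnbhs_neq 0) => h h0 fKh.
rewrite -normr_gt0 in h0.
rewrite /= subr0 addr0 normrZ normfV mulrC ler_pdivrMr//.
rewrite (_ : _ * `|h| = K * `|h *: v| ^+ 2); last by rewrite normrZ; ring.
exact: fKh.
Qed.

Lemma is_derive_translate f x v d :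
  is_derive 0 v (fun y => f (x + y)) d -> is_derive x v f d.
Proof.
have E : (fun h : C => h^-1 *: (((fun y => f (x + y)) \o shift 0) (h *: v) - f (x + 0))) =
    (fun h : C => h^-1 *: ((f \o shift x) (h *: v) - f x)).
  by apply/funext => h; rewrite /= !addr0 [x + _]addrC.
by move=> [df <-]; split; rewrite /derivable /derive -E.
Qed.

End Limits.

(** * Taylor remainders of power series *)

(** With s at most r / 2, the factor k coming from differentiating a monomial
of degree k is absorbed by 2 ^ k, and E + 1 powers of s are left over. *)
Lemma geometric_weight_le {C : numFieldType} (E k : nat) (s r : C) :
  (E < k)%N -> 0 < r -> 0 <= s <= r / 2 ->
  k%:R * s ^+ k <= s ^+ E.+1 * (2 / r) ^+ E.+1 * r ^+ k.
Proof.
move=> Ek r0 /andP[s0 sr].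
rewrite -{2}(subnKC Ek) exprD mulrCA -mulrA ler_wpM2l ?exprn_ge0//.
apply: (@le_trans _ _ (2 ^+ k * (r / 2) ^+ (k - E.+1))).
  rewrite ler_pM ?ler0n ?exprn_ge0 ?lerXn2r ?nnegrE ?(le_trans s0)//.
  by rewrite -natrX ler_nat ltnW// ltn_expl.
rewrite -{1 3}(subnKC Ek) !exprD -!mulrA mulrCA !exprMn !exprVn.
by rewrite le_eqVlt; apply/orP; left; apply/eqP; field; rewrite !expf_neq0 ?gt_eqF.
Qed.

Section PowerSeries.
Context {R : realType} {n : nat}.
Local Notation C := (Cplx R).
Implicit Types (x y a : 'rV[C]_n) (c : multinom n -> C).

(** The Taylor polynomial of order k - 1: degrees are strictly below k, matching
    the index type of the partial sums. *)
Definition jet c (k : nat) : mpoly n C :=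
  \sum_(m : bmultinom n k) c m *: mpolyX C m.

Lemma mcoeff_jet c k m : mcoeff m (jet c k) = if (mdeg m < k)%N then c m else 0.
Proof.
case: ifP => mk; first by rewrite mcoeff_mpoly.
rewrite /jet raddf_sum big1//= => m' _; rewrite mcoeffZ mcoeffX.
by case: eqVneq => [m'm|]; [rewrite -m'm bmdeg in mk|rewrite mulr0].
Qed.

Lemma meval_jet c k N x : (k <= N)%N ->
  meval (x 0) (jet c k) =
  \sum_(m : bmultinom n N) mcoeff m (jet c k) * monom_at x m.
Proof.
move=> kN; have {1}-> : jet c k = jet (fun m => mcoeff m (jet c k)) N.
  apply/mpolyP => m; rewrite [RHS]mcoeff_jet; case: ifPn => //.
  by rewrite -leqNgt => Nm; rewrite mcoeff_jet ltnNge (leq_trans kN Nm).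
rewrite /jet raddf_sum; apply: eq_bigr => m _.
by rewrite /= mevalZ mevalX.
Qed.

Lemma monom_at_scale (t : C) x m : monom_at (t *: x) m = t ^+ mdeg m * monom_at x m.
Proof.
rewrite /monom_at mdegE -prodrXr -big_split /=; apply: eq_bigr => i _.
by rewrite mxE exprMn.
Qed.

(** The remainder f - T of the Taylor polynomial T of order E is Lipschitz on the
ball of radius s, with a constant O(s ^ E). Each monomial of degree k > E of
the remainder has Lipschitz constant k s ^ (k - 1), and these constants sum up
against the absolutely convergent series at a point with equal coordinates r.
The estimate bounds the remainder (take y = 0) as well as its first partial
derivatives (let y tend to x). *)
Lemma power_series_taylor (f : 'rV[C]_n -> C) a c E : power_series_at f a c ->
  exists K r : C, 0 < r /\ forall (s : C) x y, 0 < s <= r ->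
    `|x| <= s -> `|y| <= s ->
    `|(f (a + x) - meval (x 0) (jet c E.+1))
      - (f (a + y) - meval (y 0) (jet c E.+1))| <= K * s ^+ E * `|x - y|.
Proof.
move=> /nbhs_normP[e /= e0 He].
have inball x : `|x| < e -> ball_ Num.norm 0 e x by rewrite /= sub0r normrN.
(* The diagonal point r u lies in the ball of convergence, and the monomial of
   exponent m takes the value r ^ |m| there. *)
pose u : 'rV[C]_n := const_mx 1.
have u0 : 0 < 1 + `|u| by rewrite ltr_pwDl.
pose r := e / (1 + `|u|).
have r0 : 0 < r by rewrite divr_gt0.
have ru : `|r *: u| < e.
  rewrite normrZ gtr0_norm// mulrAC ltr_pdivrMr// ltr_pM2l//.
  by rewrite ltrDr.
have re : r <= e by rewrite ler_pdivrMr// ler_peMr ?lerDl ?(ltW e0).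
have [B HB] : exists B : C, forall N : nat,
    \sum_(m : bmultinom n N) `|c m * monom_at (r *: u) m| <= B.
  exact: (He _ (inball _ ru)).1.
have monomu m : monom_at (r *: u) m = r ^+ mdeg m.
  rewrite monom_at_scale (_ : monom_at u m = 1) ?mulr1//.
  by rewrite /monom_at big1// => i _; rewrite mxE expr1n.
exists ((2 / r) ^+ E.+1 * B), (r / 2).
have r20 : 0 < r / 2 by rewrite divr_gt0.
split=> // s x y /andP[s0 sr] xs ys.
have cvgS (z : 'rV[C]_n) : `|z| <= s ->
    (fun N : nat => \sum_(m : bmultinom n N) c m * monom_at z m) @ \oo --> f (a + z).
  move=> zs; apply: (He _ (inball _ _)).2; apply: le_lt_trans zs _.
  apply: le_lt_trans sr _; apply: lt_le_trans re.
  by rewrite ltr_pdivrMr// ltr_pMr// ltr1n.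
pose S (z : 'rV[C]_n) (N : nat) : C :=
  \sum_(m : bmultinom n N) c m * monom_at z m - meval (z 0) (jet c E.+1).
have cvgST (z : 'rV[C]_n) : `|z| <= s -> S z @ \oo --> f (a + z) - meval (z 0) (jet c E.+1).
  by move=> zs; apply: cvgB; [exact: cvgS|exact: cvg_cst].
apply: norm_cvg_le (cvgB (cvgST _ xs) (cvgST _ ys)) _.
near=> N.
have EN : (E < N)%N by near: N; exact: nbhs_infty_gt.
rewrite -[X in `|X|]/(S x N - S y N) /S !(@meval_jet _ _ N)// -!sumrB.
rewrite -(ler_pM2l s0) -{1}(gtr0_norm s0) -normrM mulr_sumr.
apply: le_trans (ler_norm_sum _ _ _) _.
rewrite [leRHS](_ : _ = s ^+ E.+1 * (2 / r) ^+ E.+1 * `|x - y| * B); last first.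
  by rewrite [s ^+ E.+1]exprS; ring.
apply: le_trans (ler_wpM2l _ (HB N)); last by rewrite !mulr_ge0// ?exprn_ge0// ltW// divr_gt0.
rewrite mulr_sumr; apply: ler_sum => m _.
rewrite mcoeff_jet; case: ltnP => [_|Em].
  by rewrite !subrr mulr0 normr0 !mulr_ge0// ?exprn_ge0// ltW// divr_gt0.
rewrite !mul0r !subr0 -mulrBr mulrCA !normrM monomu normrX (gtr0_norm s0) (gtr0_norm r0).
rewrite [leRHS]mulrCA ler_wpM2l//.
apply: le_trans (monom_lipschitz _ _ _ _ xs ys) _.
rewrite [leRHS]mulrAC ler_wpM2r//; apply: geometric_weight_le => //.
by rewrite (ltW s0).
Unshelve. all: by end_near. Qed.

End PowerSeries.

(** * Leading terms along a line *)

Section LeadingTerms.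
Context {R : realType} {n : nat}.
Local Notation C := (Cplx R).
Implicit Types (x y a v : 'rV[C]_n) (c : multinom n -> C) (f : 'rV[C]_n -> C).

Lemma meval_jet0 c k : meval ((0 : 'rV[C]_n) 0) (jet c k.+1) = c mnm0.
Proof.
rewrite (@meval_eq _ _ _ (fun=> 0)) => [|i]; last by rewrite mxE.
by rewrite meval_at0 mcoeff_jet mdeg0.
Qed.

Lemma jet_homog c e m : (forall m, (mdeg m < e)%N -> c m = 0) ->
  mcoeff m (jet c e.+1) != 0 -> mdeg m = e.
Proof.
move=> c0; rewrite mcoeff_jet ltnS; case: leqP => [me|_]; last by rewrite eqxx.
by apply: contra_neq_eq => mNe; apply: c0; rewrite ltn_neqAle mNe.
Qed.

Lemma mderiv_jet_homog c e i m : (forall m, (mdeg m < e.+1)%N -> c m = 0) ->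
  mcoeff m (mderiv i (jet c e.+2)) != 0 -> mdeg m = e.
Proof.
move=> c0; rewrite mcoeff_deriv mulrn_eq0 /= => /jet_homog.
by rewrite mdegD mdeg1 addn1 => /(_ c0) [].
Qed.

Lemma power_series_center f a c : power_series_at f a c -> f a = c mnm0.
Proof.
move=> /nbhs_singleton[_]; rewrite addr0 => S0.
apply: (norm_cvg_unique S0); apply: cvg_near_cst.
near=> N; have N0 : (0 < N)%N by near: N; exact: nbhs_infty_gt.
rewrite -(meval_jet0 c N.-1) prednK// /jet raddf_sum; apply: eq_bigr => m _.
by rewrite /= mevalZ mevalX.
Unshelve. all: by end_near. Qed.

(** Subtracting the Taylor polynomial of order 1 leaves a function which is
O(|x| ^ 2) and hence has zero derivative at the centre. *)
Lemma is_derive_power_series f a c i : power_series_at f a c ->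
  is_derive a (delta_mx 0 i) f (c (mnm1 i)).
Proof.
move=> fc; apply: is_derive_translate.
pose T y := meval (y 0) (jet c 2).
have dT : is_derive 0 (delta_mx 0 i) T (c (mnm1 i)).
  apply: is_derive_eq (is_derive_meval _ _ _) _.
  rewrite (@meval_eq _ _ _ (fun=> 0)) => [|j]; last by rewrite mxE.
  by rewrite meval_at0 mcoeff_deriv mcoeff_jet mdegD mdeg0 mdeg1 mnm0E add0m.
rewrite (_ : (fun y => f (a + y)) = T + (fun y => f (a + y) - T y)); last first.
  by apply/funext => y; rewrite fctE /= addrC subrK.
rewrite -[c _]addr0; apply: is_deriveD.
have [K [r [r0 fK]]] := power_series_taylor _ _ _ 1 fc.
apply: (@is_derive0_quadratic _ _ _ _ K); near=> x.
have [->|x0] := eqVneq x 0; first by rewrite subrr !normr0 expr0n mulr0.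
have := fK `|x| x 0; rewrite subr0 expr1 -mulrA -expr2; apply; rewrite ?normr0 ?normr_gt0 ?x0//=.
Unshelve. all: by end_near. Qed.

(** The Taylor polynomial of order e is homogeneous of degree e, hence scales
exactly by t ^ e, and the remainder at t v is O(|t| ^ (e + 1)). *)
Lemma power_series_leading f c e v : power_series_at f 0 c ->
  (forall m, (mdeg m < e)%N -> c m = 0) ->
  (fun t : C => f (t *: v) / t ^+ e) @ 0^' --> meval (v 0) (jet c e.+1).
Proof.
move=> fc c0; have [K [r [r0 fK]]] := power_series_taylor _ _ _ e fc.
apply: (@cvg_dnbhs0_linear _ _ _ (K * (1 + `|v|) ^+ e * `|v|)); near=> t.
have t0 : t != 0 by near: t; exact: nbhs_dnbhs_neq.
have nt0 : 0 < `|t| by rewrite normr_gt0.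
have v0 : 0 < 1 + `|v| by rewrite ltr_pwDl.
have := fK (`|t| * (1 + `|v|)) (t *: v) 0.
rewrite !add0r (power_series_center _ _ _ fc) meval_jet0 subrr !subr0.
rewrite (meval_homog e _ _ _ (fun m => jet_homog c e m c0)) => H.
rewrite -[X in _ - X](mulKf (expf_neq0 e t0)) [_^-1 * _]mulrC -mulrBl.
rewrite normrM normfV normrX ler_pdivrMr ?exprn_gt0//.
rewrite (_ : _ * _ * `|t| ^+ e = K * (`|t| * (1 + `|v|)) ^+ e * `|t *: v|).
  apply: H; rewrite ?normr0 ?mulr_ge0 ?(ltW v0)//.
    rewrite mulr_gt0//= -ler_pdivlMr//; near: t; apply: dnbhs0_le.
    exact: divr_gt0.
  by rewrite normrZ ler_wpM2l// lerDr.
by rewrite normrZ exprMn; ring.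
Unshelve. all: by end_near. Qed.

(** Analyticity at the points near 0 makes f derivable there; the size of the
derivative of the remainder at t v is then read off from its Lipschitz constant
on a ball of radius O(|t|), while the partial derivative of the leading part is
homogeneous of degree e. *)
Lemma power_series_derive_leading f c e v i : power_series_at f 0 c ->
  (\forall x \near (0 : 'rV[C]_n), analytic_at f x) ->
  (forall m, (mdeg m < e.+1)%N -> c m = 0) ->
  (fun t : C => 'D_(delta_mx 0 i) f (t *: v) / t ^+ e) @ 0^' -->
    meval (v 0) (mderiv i (jet c e.+2)).
Proof.
move=> fc fan c0; have [K [r [r0 fK]]] := power_series_taylor _ _ _ e.+1 fc.
pose d : 'rV[C]_n := delta_mx 0 i.
(* |t| M bounds both |t v| and |t v + h d| as soon as |h| is at most |t|. *)
pose M := 1 + `|v| + `|d|.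
have M0 : 0 < M by rewrite /M -addrA ltr_pwDl// addr_ge0.
apply: (@cvg_dnbhs0_linear _ _ _ (K * M ^+ e.+1 * `|d|)).
have := nbhs_dnbhs (near_line v _ fan).
apply: filterS3 (nbhs_dnbhs_neq 0) (dnbhs0_le (divr_gt0 r0 M0)).
move=> t t0 tr [c' fc'].
have nt0 : 0 < `|t| by rewrite normr_gt0.
pose T y := meval (y 0) (jet c e.+2).
have dg : is_derive (t *: v) d (f - T)
    ('D_d f (t *: v) - t ^+ e * meval (v 0) (mderiv i (jet c e.+2))).
  have df : is_derive (t *: v) d f ('D_d f (t *: v)).
    by apply: derivableP; have [] := is_derive_power_series _ _ _ i fc'.
  apply: is_deriveB; apply: is_derive_eq (is_derive_meval _ _ _) _.
  exact: (meval_homog e _ _ _ (fun m => mderiv_jet_homog c e i m c0)).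
rewrite -[X in _ - X](mulKf (expf_neq0 e t0)) [_^-1 * _]mulrC -mulrBl.
rewrite normrM normfV normrX ler_pdivrMr ?exprn_gt0//.
rewrite (_ : _ * `|t| ^+ e = K * (`|t| * M) ^+ e.+1 * `|d|); last first.
  by rewrite exprMn [`|t| ^+ e.+1]exprS; ring.
have [dgv <-] := dg; apply: derive_norm_le => //.
near=> h.
have ht : `|h| <= `|t| by near: h; exact: dnbhs0_le.
have := fK (`|t| * M) (h *: d + t *: v) (t *: v).
rewrite !add0r addrK; apply.
- by rewrite mulr_gt0//= -ler_pdivlMr.
- rewrite (le_trans (ler_normD _ _))// !normrZ /M !mulrDr mulr1 addrC.
  by rewrite lerD ?lerDr// ler_wpM2r.
- by rewrite normrZ ler_wpM2l// /M addrAC lerDr addr_ge0.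
Unshelve. all: by end_near. Qed.

End LeadingTerms.

(** * Functions and bivectors in a chart *)

Section Charts.
Context {R : realType} {P : topologicalType} {n : nat}.
Local Notation C := (Cplx R).
Implicit Types (z w : chart R P n) (p : P) (A : set (chart R P n)) (f g : P -> C).

Lemma near_cinv z p (B : set P) : cdom z p -> (\forall q \near p, B q) ->
  \forall x \near cmap z p, B (cinv z x).
Proof. by move=> zp; rewrite -{1}(cmapK zp); exact: cinv_cont. Qed.

Lemma near_cmapK z p : cdom z p ->
  \forall x \near cmap z p, cmap z (cinv z x) = x.
Proof.
move=> zp; have : nbhs (cmap z p) (cmap z @` cdom z).
  by apply: open_nbhs_nbhs; split; [exact: cimg_open|exists p].
by apply: filterS => _ [q zq <-]; rewrite cmapK.
Qed.

Lemma near_cdom z p : cdom z p -> \forall q \near p, cdom z q.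
Proof. by move=> zp; apply: open_nbhs_nbhs; split => //; exact: cdom_open. Qed.

Lemma partial_d_near_eq z j f g p : cdom z p -> (\forall q \near p, f q = g q) ->
  partial_d z j f p = partial_d z j g p.
Proof. by move=> zp fg; apply: near_eq_derive; exact: near_cinv fg. Qed.

Lemma partial_d_coord z i j p : cdom z p ->
  partial_d z j (fun q => cmap z q 0 i) p = (j == i)%:R.
Proof.
move=> zp; rewrite /partial_d.
have /near_eq_derive -> : \forall x \near cmap z p,
    ((fun q => cmap z q 0 i) \o cinv z) x = x 0 i.
  by apply: filterS (near_cmapK _ _ zp) => x /= ->.
have /@derive_val -> := is_derive_coord (cmap z p) (delta_mx 0 j) i.
by rewrite mxE eqxx eq_sym.
Qed.

Lemma local_holo_coord A z i p : complex_manifold A -> A z -> cdom z p ->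
  local_holo A (fun q => cmap z q 0 i) p.
Proof.
move=> mA Az zp; apply: filterS (near_cdom _ _ zp) => q zq w Aw wq.
by have [wz _] := mfd_compat mA Aw Az; exact: wz.
Qed.

Lemma differential_at_coord z i p : cdom z p ->
  differential_at z (fun q => cmap z q 0 i) p = lin_var i.
Proof.
move=> zp; rewrite /differential_at (bigD1 i)//= big1 ?addr0.
  by rewrite partial_d_coord// eqxx scale1r.
by move=> j ji; rewrite partial_d_coord// (negPf ji) scale0r.
Qed.

Lemma pbracket_coord (Pi : chart R P n -> P -> 'M[C]_n) z i j p : cdom z p ->
  pbracket Pi z (fun q => cmap z q 0 i) (fun q => cmap z q 0 j) p = Pi z p i j.
Proof.
move=> zp; rewrite /pbracket (bigD1 i)//= [X in _ + X]big1 ?addr0; last first.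
  by move=> k ki; rewrite big1// => l _; rewrite partial_d_coord// (negPf ki) mulr0 mul0r.
rewrite (bigD1 j)//= big1 ?addr0 ?partial_d_coord ?eqxx ?mulr1//.
by move=> k kj; rewrite [X in _ * X]partial_d_coord// (negPf kj) mulr0.
Qed.

Lemma poly_bracket_lin_var (Q : 'M[mpoly n C]_n) i j :
  poly_bracket Q (lin_var i) (lin_var j) = Q i j.
Proof.
rewrite /poly_bracket (bigD1 i)//= [X in _ + X]big1 ?addr0; last first.
  by move=> k ki; rewrite big1// => l _; rewrite !mderiv_var (negPf ki) mulr0 mul0r.
rewrite (bigD1 j)//= big1 ?addr0 ?mderiv_var ?eqxx ?mulr1//.
by move=> k kj; rewrite !mderiv_var (negPf kj) mulr0.
Qed.

(** For a function vanishing at p, the differential is its Taylor polynomial of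
order 1; this puts the entries of the linearization in the form in which
leading terms along lines are computed. *)
Lemma differential_at_jet z f p c : power_series_at (f \o cinv z) (cmap z p) c ->
  c mnm0 = 0 -> differential_at z f p = jet c 2.
Proof.
move=> fc c0; apply/mpolyP => m; rewrite mcoeff_jet /differential_at raddf_sum /=.
have D j : mcoeff m (partial_d z j f p *: lin_var j) = c (mnm1 j) * (mnm1 j == m)%:R.
  rewrite mcoeffZ mcoeffX /partial_d.
  by have /@derive_val -> := is_derive_power_series _ _ _ j fc.
under eq_bigr do rewrite D.
case: (ltngtP (mdeg m) 1) => [m1|m1|m1]; last 1 first.
- have /existsP[k /eqP ->] : [exists k, m == mnm1 k] by rewrite -mdeg_eq1 m1.
  rewrite mdeg1 ltnS leqnn (bigD1 k)//= eqxx mulr1 big1 ?addr0// => j jk.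
  case: eqP => [/mnmP/(_ k)|]; last by rewrite mulr0.
  by rewrite !mnm1E eqxx (negPf jk).
- have /eqP mE : m == mnm0 by rewrite -mdeg_eq0 -leqn0 -ltnS.
  by rewrite mE mdeg0 c0 big1// => j _; rewrite mnm1_eq0 mulr0.
- rewrite ltnNge m1 big1// => j _; case: eqP => [mE|]; last by rewrite mulr0.
  by rewrite -mE mdeg1 in m1.
Qed.

(** Apply the defining property of the linearization to two coordinate
functions, whose bracket is the corresponding entry of the bivector. *)
Lemma linearization_entry A (Pi : chart R P n -> P -> 'M[C]_n) z p Q i j :
  complex_manifold A -> A z -> cdom z p -> is_linearization A Pi z p Q ->
  Q i j = differential_at z (fun q => Pi z q i j) p.
Proof.
move=> mA Az zp [_ linQ].
have := linQ _ _ (local_holo_coord _ _ i _ mA Az zp) (local_holo_coord _ _ j _ mA Az zp).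
rewrite (differential_at_coord _ i _ zp) (differential_at_coord _ j _ zp).
rewrite poly_bracket_lin_var => ->.
have Piij : \forall q \near p, pbracket Pi z (fun q => cmap z q 0 i)
    (fun q => cmap z q 0 j) q = Pi z q i j.
  by apply: filterS (near_cdom _ _ zp) => q; exact: pbracket_coord.
rewrite /differential_at; apply: eq_bigr => k _.
by rewrite (partial_d_near_eq _ k _ _ _ zp Piij).
Qed.

(** All coefficients below degree e vanish, so restricting the sum to degree e
changes nothing in the Taylor polynomial of order e. *)
Lemma lowest_termE z f p L : is_lowest_term z f p L ->
  exists c e, [/\ power_series_at (f \o cinv z) (cmap z p) c,
    forall m, (mdeg m < e)%N -> c m = 0 & L = jet c e.+1].
Proof.
move=> [c [e [fc _ c0 ->]]]; exists c, e; split=> //.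
rewrite /jet big_mkcond; apply: eq_bigr => m _; case: eqP => // me.
rewrite c0 ?scale0r// ltn_neqAle -ltnS bmdeg andbT; exact/eqP.
Qed.

Lemma poly_bracketCl (Q : 'M[mpoly n C]_n) a F : poly_bracket Q (mpolyC n a) F = 0.
Proof.
by rewrite /poly_bracket big1// => i _; rewrite big1// => j _; rewrite mderivC mulr0 mul0r.
Qed.

Lemma poly_bracketCr (Q : 'M[mpoly n C]_n) a F : poly_bracket Q F (mpolyC n a) = 0.
Proof.
by rewrite /poly_bracket big1// => i _; rewrite big1// => j _; rewrite mderivC mulr0.
Qed.

Lemma jet1 (c : multinom n -> C) : jet c 1 = mpolyC n (c mnm0).
Proof.
apply/mpolyP => m; rewrite mcoeff_jet mcoeffC ltnS leqn0 mdeg_eq0.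
by case: eqVneq => [->|]; rewrite ?mulr1 ?mulr0.
Qed.

End Charts.

(** * Lowest degree terms Poisson commute *)

Theorem lemma2p12 (R : realType) (P : topologicalType) (n : nat)
    (A : set (chart R P n)) (Pi : chart R P n -> P -> 'M[Cplx R]_n)
    (hP : poisson_manifold A Pi)
    (p0 : P) (hPi0 : forall z, A z -> cdom z p0 -> Pi z p0 = 0)
    (z : chart R P n) (hz : A z) (hzp0 : cdom z p0) (hz0 : cmap z p0 = 0)
    (Q : 'M[mpoly n (Cplx R)]_n) (hQ : is_linearization A Pi z p0 Q)
    (phi psi : P -> Cplx R)
    (hphi : local_holo A phi p0) (hpsi : local_holo A psi p0)
    (hphi0 : ~ \forall p \near p0, phi p = 0)
    (hpsi0 : ~ \forall p \near p0, psi p = 0)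
    (lambda : Cplx R)
    (hbr : \forall p \near p0,
       pbracket Pi z phi psi p = lambda * phi p * psi p)
    (philow psilow : mpoly n (Cplx R))
    (hphilow : is_lowest_term z phi p0 philow)
    (hpsilow : is_lowest_term z psi p0 psilow) :
  poly_bracket Q philow psilow = 0.
Proof.
have [c [[|e] [phic c0 ->]]] := lowest_termE _ _ _ _ hphilow.
  by rewrite jet1 poly_bracketCl.
have [c' [[|d] [psic c'0 ->]]] := lowest_termE _ _ _ _ hpsilow.
  by rewrite jet1 poly_bracketCr.
have mA := pm_manifold hP.
apply: mpoly_eq0_meval => v.
have atchart (B : set P) : (\forall q \near p0, B q) ->
    \forall x \near (0 : 'rV[Cplx R]_n), B (cinv z x).
  by rewrite -hz0; exact: near_cinv.
have cmapKz : \forall x \near (0 : 'rV[Cplx R]_n), cmap z (cinv z x) = x.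
  by rewrite -hz0; exact: near_cmapK.
have analytic f : local_holo A f p0 ->
    \forall x \near (0 : 'rV[Cplx R]_n), analytic_at (f \o cinv z) x.
  move=> /atchart hf.
  have := atchart _ (near_cdom _ _ hzp0).
  by apply: filterS3 hf cmapKz => x hf xE zx; rewrite -xE; exact: hf.
rewrite hz0 in phic psic.
(* S t is the bracket at the point t v, divided by t ^ (1 + e + d). *)
pose S (t : Cplx R) := \sum_(i < n) \sum_(j < n)
  (Pi z (cinv z (t *: v)) i j / t ^+ 1 *
   ('D_(delta_mx 0 i) (phi \o cinv z) (t *: v) / t ^+ e)) *
   ('D_(delta_mx 0 j) (psi \o cinv z) (t *: v) / t ^+ d).
have limS : S @ 0^' --> meval (v 0) (poly_bracket Q (jet c e.+2) (jet c' d.+2)).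
  rewrite /S /poly_bracket raddf_sum; apply: cvg_big => [|i _]; first exact: add_continuous.
  rewrite raddf_sum; apply: cvg_big => [|j _]; first exact: add_continuous.
  rewrite /= !mevalM; apply: cvgM; last first.
    exact: (power_series_derive_leading _ _ _ _ _ psic (analytic _ hpsi) c'0).
  apply: cvgM; last first.
    exact: (power_series_derive_leading _ _ _ _ _ phic (analytic _ hphi) c0).
  have [b Pib] := biv_holo (pm_bivector hP) i j hz hzp0 hz hzp0.
  have b0 : b mnm0 = 0.
    by rewrite -(power_series_center _ _ _ Pib) /= cmapK// hPi0// mxE.
  rewrite (linearization_entry _ _ _ _ _ i j mA hz hzp0 hQ).
  rewrite (differential_at_jet _ _ _ _ Pib)//.
  rewrite hz0 in Pib; apply: (power_series_leading _ _ _ _ Pib) => m.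
  by rewrite ltnS leqn0 mdeg_eq0 => /eqP ->.
(* The product phi psi has order e + d + 2 along the line, one more than the
   power of t by which it is divided. *)
have lim0 : S @ 0^' --> (0 : Cplx R).
  pose F (t : Cplx R) := lambda * ((phi \o cinv z) (t *: v) / t ^+ e.+1)
    * ((psi \o cinv z) (t *: v) / t ^+ d.+1) * t.
  have : F @ 0^' --> lambda * meval (v 0) (jet c e.+2) *
      meval (v 0) (jet c' d.+2) * 0.
    apply: cvgM; last exact: nbhs_dnbhs.
    apply: cvgM; last exact: power_series_leading.
    by apply: cvgM; [exact: cvg_cst|exact: power_series_leading].
  rewrite mulr0; apply: cvg_trans; apply: near_eq_cvg.
  have := nbhs_dnbhs (near_line v _ (atchart _ hbr)).
  have := nbhs_dnbhs (near_line v _ cmapKz).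
  apply: filterS3 (nbhs_dnbhs_neq 0) => t t0 xE br.
  transitivity (pbracket Pi z phi psi (cinv z (t *: v)) / (t * t ^+ e * t ^+ d)).
    rewrite br /F /= !exprS; field.
    by rewrite !expf_neq0.
  rewrite /pbracket /S mulr_suml; apply: eq_bigr => i _.
  rewrite mulr_suml; apply: eq_bigr => j _.
  by rewrite /partial_d xE expr1 !mulf_div.
exact: (norm_cvg_unique limS lim0).
Qed.
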